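(* (i) For every integer $t\ge1$, $\mathrm{rrsat}(n,K_{t+2})=\Omega(n^{3/2})$. (ii) For every integer $t\ge 1$ there is a constant $C_t$ depending only on $t$ such that $\liminf_{n\to\infty}\frac{\mathrm{rrsat}(n,K_{t+2})}{n^{3/2}}\le C_t$.
   Context: All graphs are finite and simple. A graph is regular if all vertices have the same degree. For a graph $F$, $\mathrm{rrsat}(n,F)$ denotes the smallest number of edges of a regular $n$-vertex graph $G$ that contains no copy of $F$ and such that every regular $n$-vertex graph properly containing $G$ (i.e. obtained from $G$ by adding at least one edge on the same vertex set) contains a copy of $F$. $K_r$ denotes the complete graph on $r$ vertices. *)

(* Defs.v *)
From mathcomp Require Import all_boot all_order all_algebra.
From mathcomp Require Import all_classical all_reals all_analysis.
Set Implicit Arguments. Unset Strict Implicit. Unset Printing Implicit Defensive.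

(* A simple graph on the vertex set 'I_n is represented by its set of
   ordered adjacent pairs E : {set 'I_n * 'I_n}, required to be symmetric
   and irreflexive.  Its number of edges is #|E| / 2. *)
Definition simple_graph (n : nat) (E : {set 'I_n * 'I_n}) : bool :=
  [forall u, forall v, ((u, v) \in E) == ((v, u) \in E)] &&
  [forall u, (u, u) \notin E].

Definition nedges (n : nat) (E : {set 'I_n * 'I_n}) : nat := #|E| %/ 2.

Definition deg (n : nat) (E : {set 'I_n * 'I_n}) (v : 'I_n) : nat :=
  #|[set u | (v, u) \in E]|.

Definition regular (n : nat) (E : {set 'I_n * 'I_n}) : bool :=
  [forall u, forall v, deg E u == deg E v].

Definition has_Kr (r n : nat) (E : {set 'I_n * 'I_n}) : Prop :=
  exists f : 'I_r -> 'I_n, injective f /\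
    forall i j : 'I_r, i != j -> (f i, f j) \in E.

Definition rrsat_graph (r n : nat) (E : {set 'I_n * 'I_n}) : Prop :=
  [/\ simple_graph E, regular E, ~ has_Kr r E &
      forall E' : {set 'I_n * 'I_n}, simple_graph E' -> regular E' ->
        E \proper E' -> has_Kr r E'].

(* rrsat(n, K_r): smallest number of edges of such a graph.  The empty graph
   is regular and K_r-free (r >= 2), and the class of graphs is finite, so a
   maximal one always exists; the default value n*n (>= any edge count) of
   the min is then never the unique attained value. *)
Definition rrsat (n r : nat) : nat :=
  \big[minn/(n * n)]_(E : {set 'I_n * 'I_n} | `[< rrsat_graph r E >]) nedges E.

(* Main.v *)
(* Lower bound: let [E] be [d]-regular on [n] vertices with [8 (1 + d + d^2) < n].
   A Sauer--Spencer packing argument yields a Hamilton cycle in which any two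
   vertices at cyclic distance 1 or 2 are at distance at least 3 in [E].  Adding
   this cycle keeps the graph regular and creates no new triangle, hence no new
   [K_r] for [r >= 3].  So [d] is at least of order [sqrt n].

   Upper bound: a single vertex [v] whose every non-edge closes a [K_{t+2}]
   already excludes all proper regular supergraphs.  Let [m] be even.  The
   neighbourhood of [v] consists of [m] disjoint copies [A_j] of [K_t]; each [A_j]
   is completely joined to an independent set [B_j] of size [t (m - 1)], and the
   sets [B_j] are paired up into complete bipartite graphs.  This graph is
   [t m]-regular on [1 + t m^2] vertices. *)
Require Import Defs.
From mathcomp Require Import all_boot all_order all_algebra.
From mathcomp Require Import all_classical all_reals all_analysis.
From mathcomp Require Import fintype finset fingroup perm zify lra.
Import Order.TTheory GRing.Theory Num.Theory.
Local Open Scope nat_scope.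

Lemma card_bigcup_le (T I : finType) (A : {set I}) (F : I -> {set T}) b :
  (forall i, #|F i| <= b) -> #|\bigcup_(i in A) F i| <= #|A| * b.
Proof.
move=> Fb; rewrite -sum_nat_const.
apply: (big_ind2 (fun (B : {set T}) m => #|B| <= m)) => [|B m C k Bm Ck|i _].
- by rewrite cards0.
- by rewrite cardsU; lia.
- exact: Fb.
Qed.

(** * Packing two relations of bounded degree *)

Section Packing.
Variables (T : finType) (P B : rel T) (a b : nat).
Hypotheses (Psym : symmetric P) (Pirr : irreflexive P).
Hypotheses (Bsym : symmetric B) (Brefl : reflexive B).
Hypothesis Pdeg : forall x, #|[set y | P x y]| <= a.
Hypothesis Bdeg : forall x, #|[set y | B x y]| <= b.

Let conflicts (s : {perm T}) :=
  [set e : T * T | P e.1 e.2 && B (s e.1) (s e.2)].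

(** Exchange the images of a conflicting [x] and of a suitable [z]: afterwards no pair at [x] or [z]
    is in conflict, and all other pairs are unchanged. *)
Lemma fewer_conflicts (s : {perm T}) : 2 * (a * b) < #|T| ->
  0 < #|conflicts s| -> exists s' : {perm T}, #|conflicts s'| < #|conflicts s|.
Proof.
move=> ab /card_gt0P[[x y]]; rewrite inE /= => /andP[Pxy Bxy].
(* The two unions collect the [z] for which the swap would leave a conflict at [x], respectively at
   [z]; each has at most [a * b] elements. *)
pose blocked := (\bigcup_(w in [set w | P x w]) [set z | B (s w) (s z)]) :|:
  (\bigcup_(w in [set w | B (s x) (s w)]) [set z | P w z]).
have card_s (C : {set T}) : #|[set w | s w \in C]| = #|C|.
  rewrite -(card_preimset C (@perm_inj _ s)).
  by apply: eq_card => w; rewrite !inE.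
have blocked_lt : #|blocked| < #|T|.
  have card_B v : #|[set z | B v (s z)]| <= b.
    apply: leq_trans (Bdeg v); rewrite -(card_s [set z | B v z]).
    by apply/subset_leq_card/subsetP => z; rewrite !inE.
  apply: leq_ltn_trans ab; rewrite mul2n -addnn.
  rewrite cardsU; apply: leq_trans (leq_subr _ _) (leq_add _ _).
    apply: leq_trans (card_bigcup_le _ _ _ _ b _) _ => [w|]; first exact: card_B.
    by rewrite leq_mul2r Pdeg orbT.
  apply: leq_trans (card_bigcup_le _ _ _ _ a Pdeg) _.
  by rewrite mulnC leq_mul2l card_B orbT.
have /existsP[z] : [exists z, z \notin blocked].
  apply: contraTT blocked_lt => /existsPn all_blocked.
  rewrite -leqNgt; apply: subset_leq_card; apply/subsetP => z _.
  exact: negbNE (all_blocked z).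
rewrite inE negb_or => /andP[/bigcupP zP /bigcupP zB].
have noB w : P x w -> ~~ B (s z) (s w).
  by move=> Pxw; apply/negP => Bzw; apply: zP; exists w; rewrite inE // Bsym.
have noP w : P z w -> ~~ B (s x) (s w).
  by move=> Pzw; apply/negP => Bxw; apply: zB; exists w; rewrite inE // Psym.
(* Here reflexivity of [B] enters. With [Pirr] it follows that the transposition fixes all
   [P]-neighbours of [x] and of [z]. *)
have NPxz : ~~ P x z by apply/negP => /noB; rewrite Brefl.
pose s' := (tperm x z * s)%g.
have s'E w : s' w = s (tperm x z w) by rewrite permM.
have noconf v w : P v w -> (v == x) || (v == z) -> ~~ B (s' v) (s' w).
  move=> Pvw /orP[] /eqP v_; subst v; rewrite !s'E ?tpermL ?tpermR tpermD.
  - exact: noB.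
  - by apply: contraL Pvw => /eqP <-; rewrite Pirr.
  - by apply: contraL Pvw => /eqP <-.
  - exact: noP.
  - by apply: contraL Pvw => /eqP <-; rewrite Psym.
  - by apply: contraL Pvw => /eqP <-; rewrite Pirr.
exists s'; apply: proper_card; apply/properP; split; last first.
  by exists (x, y); rewrite !inE /= ?Pxy //= noconf // eqxx.
apply/subsetP => -[v w]; rewrite !inE /= => /andP[Pvw Bvw]; rewrite Pvw /=.
have := contraL (noconf v w Pvw) Bvw; rewrite negb_or => /andP[vx vz].
have Bwv : B (s' w) (s' v) by rewrite Bsym.
have Pwv : P w v by rewrite Psym.
have := contraL (noconf w v Pwv) Bwv; rewrite negb_or => /andP[wx wz].
by move: Bvw; rewrite !s'E !tpermD // eq_sym.
Qed.

(* Sauer--Spencer packing; [B] is taken reflexive, so that no separate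
   non-degeneracy conditions on the swapped vertices are needed. *)
Lemma packing : 2 * (a * b) < #|T| ->
  exists s : {perm T}, forall x y, P x y -> ~~ B (s x) (s y).
Proof.
move=> ab.
have [s _ s_min] : {s : {perm T} | true &
    forall s', true -> #|conflicts s| <= #|conflicts s'|}.
  by case: (arg_minnP (fun s => #|conflicts s|) (i0 := 1%g) (P := xpredT)) => // s;
    exists s.
exists s => x y Pxy; apply/negP => Bxy.
have [|s' lt_s'] := fewer_conflicts s ab.
  by apply/card_gt0P; exists (x, y); rewrite inE Pxy.
by have := s_min s' isT; rewrite leqNgt lt_s'.
Qed.

End Packing.

(** * Basic facts on encoded graphs *)

Lemma simple_graphP n (E : {set 'I_n * 'I_n}) :
  reflect ((forall u v, ((u, v) \in E) = ((v, u) \in E)) /\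
           (forall u, (u, u) \notin E))
          (simple_graph E).
Proof.
apply: (iffP andP) => -[Esym Eirr]; split.
- by move=> u v; apply/eqP; move/forallP/(_ u)/forallP/(_ v): Esym.
- exact/forallP.
- by apply/forallP => u; apply/forallP => v; rewrite Esym.
- exact/forallP.
Qed.

Lemma regularP n (E : {set 'I_n * 'I_n}) :
  reflect (forall u v, deg E u = deg E v) (regular E).
Proof.
apply: (iffP forallP) => [Er u v|Er u].
  by apply/eqP; move/forallP: (Er u).
by apply/forallP => v; rewrite (Er u v).
Qed.

Lemma card_edges n (E : {set 'I_n * 'I_n}) d :
  (forall v, deg E v = d) -> #|E| = n * d.
Proof.
move=> Ed; rewrite -[n in RHS]card_ord -sum_nat_const -sum1_card.
rewrite [RHS](eq_bigr (fun v => \sum_(u | (v, u) \in E) 1)) => [|v _].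
  by rewrite pair_big_dep; apply: eq_bigl => -[u v].
by rewrite -(Ed v) /deg -sum1_card; apply: eq_bigl => u; rewrite inE.
Qed.

Lemma rrsat_le_nedges n r (E : {set 'I_n * 'I_n}) :
  rrsat_graph r E -> rrsat n r <= nedges E.
Proof. by move=> /asboolP HE; apply: (@bigmin_le_cond _ nat). Qed.

(** * Lower bound: adding a Hamilton cycle *)

Definition close n (E : {set 'I_n * 'I_n}) (u v : 'I_n) : bool :=
  [|| u == v, (u, v) \in E | [exists w, ((u, w) \in E) && ((w, v) \in E)]].

Lemma close_refl n (E : {set 'I_n * 'I_n}) : reflexive (close n E).
Proof. by move=> u; rewrite /close eqxx. Qed.

Lemma close_sym n (E : {set 'I_n * 'I_n}) :
  simple_graph E -> symmetric (close n E).
Proof.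
move=> /simple_graphP[Esym _] u v; rewrite /close eq_sym Esym.
congr [|| _, _ | _]; apply: eq_existsb => w.
by rewrite andbC Esym [(u, w) \in E]Esym.
Qed.

Lemma card_close n (E : {set 'I_n * 'I_n}) d u : (forall v, deg E v = d) ->
  #|[set v | close n E u v]| <= 1 + d + d * d.
Proof.
move=> Ed.
pose N v := [set w | (v, w) \in E].
have NE v : #|N v| = d by rewrite -(Ed v).
suff /subset_leq_card le_close :
    [set v | close n E u v] \subset u |: N u :|: \bigcup_(w in N u) N w.
  apply: leq_trans le_close _.
  have := card_bigcup_le _ _ (N u) N d (fun i => eq_leq (NE i)).
  by rewrite !cardsU cards1 NE; lia.
apply/subsetP => v; rewrite !inE => /or3P[/eqP ->|->|/existsP[w /andP[uw wv]]].
- by rewrite eqxx.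
- by rewrite orbT.
- by apply/orP; right; apply/bigcupP; exists w; rewrite inE.
Qed.

(** Puts every edge of a clique on at least 3 vertices into a triangle, so an edge in no triangle
    lies in no such clique. *)
Lemma third_vertex r (i j : 'I_r) : 3 <= r -> exists l : 'I_r, l != i /\ l != j.
Proof.
move=> r3; have /existsP[l] : [exists l, l \notin [set i; j]].
  apply: contraLR r3 => /existsPn all_in; rewrite -ltnNge ltnS -[r]card_ord.
  apply: leq_trans (_ : #|[set i; j]| <= 2); last by rewrite cards2; case: eqP.
  by apply: subset_leq_card; apply/subsetP => l _; exact: negbNE (all_in l).
by rewrite !inE negb_or => /andP[li lj]; exists l.
Qed.

(* A Hamilton cycle is added in which vertices at cyclic distance 1 or 2 are far
   apart in [E], so no new edge lies in a triangle. *)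
Lemma add_hamilton_cycle n (E : {set 'I_n * 'I_n}) d :
  simple_graph E -> (forall v, deg E v = d) -> 4 <= n ->
  8 * (1 + d + d * d) < n ->
  exists E' : {set 'I_n * 'I_n}, [/\ simple_graph E', regular E', E \proper E' &
    forall r, 3 <= r -> has_Kr r E' -> has_Kr r E].
Proof.
(* In the form [k.+4] the vertex type is the ring of integers modulo [n], where 2 and 3 are nonzero;
   hence 1 and -1 differ, and 2 is neither. *)
case: n E => [|[|[|[|k]]]] // E Esimple Ed _ dn.
have [Esym Eirr] := simple_graphP _ _ Esimple.
pose near1 (x : 'I_k.+4) := (x \in [:: 1; -1])%R.
pose near2 (x : 'I_k.+4) := (x \in [:: 1; -1; 2; -2])%R.
have near1N x : near1 (- x)%R = near1 x.
  by rewrite /near1 !inE eqr_oppLR eqr_opp orbC.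
have near2N x : near2 (- x)%R = near2 x.
  by rewrite /near2 !inE !eqr_oppLR !opprK; do 4 case: (x == _).
have near12 x : near1 x -> near2 x.
  by rewrite /near1 /near2 !inE => /orP[] ->; rewrite ?orbT.
pose P (x y : 'I_k.+4) := near2 (y - x)%R.
have Psym : symmetric P by move=> x y; rewrite /P -opprB near2N.
have near2_0 : near2 0%R = false.
  by rewrite /near2 !inE ![(0 == _)%R]eq_sym !oppr_eq0.
have near1_2 : near1 2%R = false by rewrite /near1 !inE -addr_eq0.
have Pirr : irreflexive P by move=> x; rewrite /P subrr.
have Pdeg x : #|[set y | P x y]| <= 4.
  pose s := [seq (x + e)%R | e <- [:: 1; -1; 2; -2]%R].
  apply: leq_trans (card_size s); apply/subset_leq_card/subsetP => y.
  rewrite inE => Pxy; apply/mapP; exists (y - x)%R => //.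
  by rewrite addrC subrK.
(* The degree bounds 4 and [1 + d + d * d] turn the packing condition into the hypothesis with
   constant 8. *)
have [|s sP] := packing _ P (close _ E) 4 (1 + d + d * d) Psym Pirr
    (close_sym _ _ Esimple) (close_refl _ _) Pdeg (fun u => card_close _ _ _ u Ed).
  by rewrite card_ord mulnA.
(* [q] gives the position of a vertex on the cycle, and [C] joins consecutive positions. *)
pose q := (s^-1)%g.
pose C u v := near1 (q v - q u)%R.
have Csym u v : C u v = C v u by rewrite /C -opprB near1N.
have far u v : near2 (q v - q u)%R -> (u, v) \notin E.
  by move=> /sP; rewrite !permKV /close !negb_or => /and3P[].
have Cirr u : ~~ C u u by rewrite /C subrr; apply/negP => /near12; rewrite near2_0.
pose E' := E :|: [set e | C e.1 e.2].
have E'sym u v : ((u, v) \in E') = ((v, u) \in E') by rewrite !inE /= Esym Csym.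
have E'irr u : (u, u) \notin E' by rewrite !inE /= (negbTE (Eirr u)) Cirr.
have E'deg u : deg E' u = d + 2.
  rewrite -(Ed u) /deg.
  have -> : 2 = #|[set s (q u + 1)%R; s (q u - 1)%R]|.
    by rewrite cards2 (inj_eq perm_inj) (inj_eq (addrI _)) -addr_eq0.
  have memC v : (v \in [set s (q u + 1)%R; s (q u - 1)%R]) = C u v.
    have sq w z : (w == s z) = (q w == z).
      by rewrite -{2}[z](permK s) (inj_eq perm_inj).
    by rewrite !inE !sq /C /near1 !inE !subr_eq addrC [(-1 + _)%R]addrC.
  rewrite -cardsUI [X in _ = _ + X]eq_card0 ?addn0.
    by apply: eq_card => v; rewrite !inE /= -memC !inE.
  move=> v; rewrite inE memC !inE; apply/andP => -[uv /near12/far].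
  by rewrite uv.
(* Two cycle steps add up to 0, which gives a loop, or to 2 or -2, which is neither a cycle step nor
   an old edge. This excludes triangles with two cycle edges. *)
have chain u v w : C u v -> C v w -> (u, w) \notin E'.
  rewrite /C => Cuv Cvw; have [uw|NE] := boolP (q w - q u == 0)%R.
    move: uw; rewrite subr_eq0 (inj_eq perm_inj) => /eqP ->; exact: E'irr.
  have e : ((q w - q v) + (q v - q u) = q w - q u)%R by rewrite addrA subrK.
  have /orP two : ((q w - q u == 2) || (q w - q u == -2))%R.
    move: NE Cuv Cvw; rewrite -e /near1 !inE.
    by move=> NE /orP[] /eqP c1 /orP[] /eqP c2; move: NE;
      rewrite c1 c2 ?subrr ?addNr ?eqxx // -opprD ?eqxx ?orbT.
  rewrite !inE /= negb_or far /=.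
    by rewrite /C; case: two => /eqP ->; rewrite ?near1N near1_2.
  by rewrite /near2 !inE; case: two => ->; rewrite !orbT.
have no_triangle u v w : C u v -> (u, w) \in E' -> (v, w) \notin E'.
  move=> Cuv uw; apply/negP => vw.
  case: (boolP (C u w)) => [Cuw|NCuw].
    by have := chain v u w; rewrite Csym => /(_ Cuv Cuw); rewrite vw.
  case: (boolP (C v w)) => [Cvw|NCvw].
    by have := chain u v w Cuv Cvw; rewrite uw.
  (* The remaining triangle has one cycle edge [u v], whose ends would have the common neighbour [w]
     in [E]. *)
  move: uw vw; rewrite !inE /= (negbTE NCuw) (negbTE NCvw) !orbF => uw vw.
  have := Cuv; rewrite /C => /near12 /sP; rewrite !permKV /close !negb_or.
  by case/and3P => _ _ /existsPn/(_ w); rewrite uw Esym vw.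
exists E'; split.
- exact/simple_graphP.
- by apply/regularP => u v; rewrite !E'deg.
- apply/properP; split; first exact: finset.subsetUl.
  have C01 : C (s 0%R) (s 1%R) by rewrite /C /q !permK subr0.
  exists (s 0%R, s 1%R); first by rewrite !inE /= C01 orbT.
  by apply: far; apply: near12.
- move=> r r3 [f [f_inj fE']]; exists f; split=> // i j ij.
  have := fE' i j ij; rewrite !inE /= => /orP[//|Cij].
  have [l [li lj]] := third_vertex r i j r3.
  have := no_triangle _ _ (f l) Cij; rewrite !fE' 1?eq_sym // => /(_ isT).
  by [].
Qed.

Lemma rrsat_graph_degree n r (E : {set 'I_n * 'I_n}) d : 3 <= r -> 4 <= n ->
  rrsat_graph r E -> (forall v, deg E v = d) -> n <= 8 * (1 + d + d * d).
Proof.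
move=> r3 n4 [Esimple _ Efree Emax] Ed; rewrite leqNgt; apply/negP => dn.
have [E' [E'simple E'reg EE' K]] := add_hamilton_cycle _ _ _ Esimple Ed n4 dn.
by apply/Efree/(K _ r3)/Emax.
Qed.

(** Allows cliques indexed by any finite type; injectivity of [g] follows from the absence of
    loops. *)
Lemma has_Kr_family n (E : {set 'I_n * 'I_n}) r (I : finType) (g : I -> 'I_n) :
  simple_graph E -> #|I| = r -> (forall i j, i != j -> (g i, g j) \in E) ->
  has_Kr r E.
Proof.
move=> /simple_graphP[_ Eirr] <- gE; exists (g \o enum_val); split=> [i j /= gij|i j ij].
  apply/eqP; apply: contraTT isT => ij.
  have := gE (enum_val i) (enum_val j); rewrite (inj_eq enum_val_inj) gij.
  by move=> /(_ ij); rewrite (negbTE (Eirr _)).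
by apply: gE; rewrite (inj_eq enum_val_inj).
Qed.

(** * Transport of graphs from an arbitrary finite type *)

Section RelGraph.
Variables (V : finType) (e : rel V).

Definition rel_graph : {set 'I_#|V| * 'I_#|V|} :=
  [set p | e (enum_val p.1) (enum_val p.2)].

Lemma rel_graph_simple : symmetric e -> irreflexive e -> simple_graph rel_graph.
Proof.
by move=> esym eirr; apply/simple_graphP; split=> [u v|u]; rewrite !inE /= ?eirr.
Qed.

Lemma deg_rel_graph u : deg rel_graph u = #|[set y | e (enum_val u) y]|.
Proof.
rewrite /deg -(card_imset _ (@enum_rank_inj V)); apply: eq_card => v.
rewrite !inE /=; apply/idP/imsetP => [uv|[y]].
  by exists (enum_val v); rewrite ?inE ?enum_valK.
by rewrite inE => uy ->; rewrite enum_rankK.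
Qed.

End RelGraph.

(** A new edge raises the degree of its ends, hence by regularity of every vertex. Saturation thus
    has to be checked at a single vertex only. *)
Lemma regular_supergraph_new_edge n (E E' : {set 'I_n * 'I_n}) v :
  regular E -> regular E' -> E \proper E' ->
  exists u, ((v, u) \in E') && ((v, u) \notin E).
Proof.
move=> /regularP Ereg /regularP E'reg /properP[EE' [[x y] xyE' xyE]].
have : deg E v < deg E' v.
  rewrite (Ereg v x) (E'reg v x); apply: proper_card; apply/properP; split.
    by apply/subsetP => u; rewrite !inE; exact: (subsetP EE').
  by exists y; rewrite inE.
move=> lt_deg; apply/existsP; apply: contraTT lt_deg => /existsPn all_old.
rewrite -leqNgt; apply/subset_leq_card/subsetP => u; rewrite !inE => vu.
by apply: contraTT (all_old u) => nvu; rewrite vu nvu.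
Qed.

(** * Upper bound: the saturated construction *)

Section Construction.
Variables t q : nat.
Let m := q.*2.+2.

(* [None] is the saturated vertex; its neighbours [(j, k, 0)] form, for each of
   the [m] values of [j], a clique of size [t], which is completely joined to
   the independent set of all [(j, k, l)] with [l != 0].  The independent sets
   of index [(i, false)] and [(i, true)] are completely joined to each other. *)
Definition vertex : finType := option ('I_q.+1 * bool * 'I_t * 'I_m).

Definition adj (x y : vertex) : bool :=
  match x, y with
  | None, None => false
  | None, Some (_, _, l) | Some (_, _, l), None => l == ord0
  | Some (j, k, l), Some (j', k', l') =>
    if l == ord0 then (j == j') && ((l' == ord0) ==> (k != k'))
    else if l' == ord0 then j == j' else (j.1 == j'.1) && (j.2 != j'.2)
  end.

Lemma adj_sym : symmetric adj.
Proof.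
move=> [[[j k] l]|] [[[j' k'] l']|] //=.
do 2 case: (_ == ord0) => //=.
- by rewrite eq_sym [k == _]eq_sym.
- by rewrite andbT eq_sym.
- by rewrite andbT eq_sym.
- by rewrite eq_sym [j.2 == _]eq_sym.
Qed.

Lemma adj_irr : irreflexive adj.
Proof.
by move=> [[[j k] l]|] //=; case: (l == _); rewrite !eqxx.
Qed.

Lemma card_vertex : #|vertex| = (t * m ^ 2).+1.
Proof.
by rewrite card_option !card_prod card_bool !card_ord /m; lia.
Qed.

(** Every neighbourhood of the construction has this form: a product in the layer [l = 0], a common
    product in the other [m.-1] layers, and possibly [None]. *)
Lemma card_layers (N : {set vertex}) (b : bool)
    (A A' : {set 'I_q.+1 * bool}) (K K' : {set 'I_t}) :
  (None \in N) = b ->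
  (forall j k l, (Some (j, k, l) \in N) =
    if l == ord0 then (j \in A) && (k \in K) else (j \in A') && (k \in K')) ->
  #|N| = b + #|A| * #|K| + #|A'| * #|K'| * m.-1.
Proof.
move=> N0 NS.
pose S (B : {set 'I_q.+1 * bool}) (H : {set 'I_t}) (L : {set 'I_m}) : {set vertex} :=
  [set Some z | z in setX (setX B H) L].
have cardS B H L : #|S B H L| = #|B| * #|H| * #|L|.
  by rewrite card_imset ?cardsX //; exact: Some_inj.
have memS j k l B H L : (Some (j, k, l) \in S B H L) = [&& j \in B, k \in H & l \in L].
  by rewrite (mem_imset _ _ (@Some_inj _)) !inE /= andbA.
have memS0 B H L : (None \in S B H L) = false by apply/imsetP => -[].
rewrite -(cardsID (S (finset.setT) (finset.setT) [set ord0])) (cardsD1 None (N :\: _)).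
have -> : N :&: S finset.setT finset.setT [set ord0] = S A K [set ord0].
  apply/setP => -[[[j k] l]|]; rewrite !inE ?memS0 ?andbF // !memS NS !inE.
  by case: (l == _); rewrite ?andbT ?andbF.
have -> : N :\: S finset.setT finset.setT [set ord0] :\ None = S A' K' [set~ ord0].
  apply/setP => -[[[j k] l]|]; rewrite !inE ?memS0 // !memS NS !inE.
  by case: (l == _); rewrite ?andbT ?andbF.
by rewrite !inE memS0 N0 !cardS cards1 cardsC1 card_ord muln1 addnA [b + _]addnC.
Qed.

(** The counts are [1 + (t - 1) + t (m - 1)] at a clique vertex, [t + t (m - 1)] at an independent
    vertex, and [m t] at [None]. *)
Lemma card_adj x : #|[set y | adj x y]| = t * m.
Proof.
have cardJ : #|{: 'I_q.+1 * bool}| = m by rewrite card_prod card_ord card_bool muln2.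
case: x => [[[j k] l]|].
- have [-> | l0] := eqVneq l ord0.
    rewrite (@card_layers _ true [set j] [set j] [set~ k] finset.setT) ?inE //.
      by rewrite !cards1 cardsC1 cardsT card_ord; case: t k => [[]|t' _]; lia.
    move=> j' k' l'; rewrite !inE /= [j' == _]eq_sym [k' == _]eq_sym.
    by case: (l' == _); rewrite ?andbT.
  rewrite (@card_layers _ false [set j] [set (j.1, ~~ j.2)] finset.setT finset.setT).
  + by rewrite !cards1 cardsT card_ord; lia.
  + by rewrite inE /= (negbTE l0).
  + move=> j' k' l'; rewrite !inE /= (negbTE l0) !andbT eq_sym.
    case: j j' => [i b] [i' b']; case: ifP => _; rewrite xpair_eqE /= eq_sym.
      by rewrite [b == _]eq_sym.
    by case: b b' => [] [].
- rewrite (@card_layers _ false finset.setT finset.set0 finset.setT finset.set0) ?inE //.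
    by rewrite !cardsT cards0 cardJ card_ord; lia.
  by move=> j k l; rewrite !inE; case: ifP.
Qed.

(** This uses [t + 1] colors but is not proper: edges between paired independent sets are
    monochromatic. *)
Definition color (x : vertex) : option 'I_t :=
  if x is Some (_, k, l) then if l == ord0 then Some k else None else None.

(** A monochromatic edge joins two paired independent sets. A common neighbour would be a clique
    vertex with both indices, or an independent vertex whose boolean differs from both. *)
Lemma adj_same_color x y z :
  adj x y -> color x = color y -> adj x z -> adj y z -> False.
Proof.
case: x => [[[[i b] k] l]|]; case: y => [[[[i' b'] k'] l']|] //=; last first.
- by move=> ->.
- by move=> ->.
case: ifP => [_|l0]; case: ifP => [_|l'0] //=.
  by case/andP => _ /eqP nk [] /nk.
case: z => [[[[i2 b2] k2] l2]|] //=.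
move=> /andP[_ bb'] _.
case: ifP => _; last by case: b b' b2 bb' => [] [] [] //; rewrite !andbF.
by rewrite !xpair_eqE => /andP[_ /eqP <-] /andP[_ /eqP b'b]; rewrite b'b eqxx in bb'.
Qed.

Lemma construction_Kr_free : 0 < t -> ~ has_Kr (t + 2) (rel_graph vertex adj).
Proof.
move=> t0 [f [_ fE]].
have hE i j : i != j -> adj (enum_val (f i)) (enum_val (f j)).
  by move=> /fE; rewrite inE.
(* Every edge of the clique lies in a triangle, so [color] is injective on its [t + 2] vertices, one
   more than there are colors. *)
have c_inj : injective (fun i => color (enum_val (f i))).
  move=> i j cij; apply/eqP; apply: contraT => ij.
  have [|l [li lj]] := third_vertex _ i j; first by rewrite addn2.
  by case: (adj_same_color _ _ (enum_val (f l)) (hE _ _ ij) cij);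
    apply: hE; rewrite eq_sym.
by have := leq_card _ c_inj; rewrite card_option !card_ord addn2 ltnn.
Qed.

Lemma construction_rrsat : 0 < t -> rrsat_graph (t + 2) (rel_graph vertex adj).
Proof.
move=> t0.
have Greg : regular (rel_graph vertex adj).
  by apply/regularP => u v; rewrite !deg_rel_graph !card_adj.
split=> //; [exact: rel_graph_simple adj_sym adj_irr|exact: construction_Kr_free|].
move=> E' E'simple E'reg GE'.
have [E'sym E'irr] := simple_graphP _ _ E'simple.
have [u /andP[ruE' ruG]] :=
  regular_supergraph_new_edge _ _ _ (enum_rank (None : vertex)) Greg E'reg GE'.
have sub x y : adj x y -> (enum_rank x, enum_rank y) \in E'.
  move=> xy; apply: (subsetP (proper_sub GE')); rewrite inE /= !enum_rankK.
  exact: xy.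
move: ruE' ruG; rewrite -{1}[u]enum_valK inE /= enum_rankK.
case: (enum_val u) => [[[j k] l]|] /=; last by rewrite (negbTE (E'irr _)).
move=> ruE' l0.
(* The clique consists of [None], its new neighbour [(j, k, l)], and the [t] clique vertices of
   index [j], which are adjacent to both. *)
pose g (i : option (option 'I_t)) : 'I_#|vertex| := enum_rank (
  if i is Some i' then if i' is Some k' then Some (j, k', ord0) else Some (j, k, l)
  else None).
apply: (has_Kr_family _ _ _ _ g) => //.
  by rewrite !card_option card_ord addn2.
move=> [[k1|]|] [[k2|]|] // k12; rewrite /g ?ruE' // 1?E'sym ?ruE' //; apply: sub => //=.
- by rewrite !eqxx /=; apply: contraNN k12 => /eqP ->.
- by rewrite eqxx (negbTE l0).
- by rewrite eqxx (negbTE l0).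
Qed.

Lemma rrsat_construction : 0 < t ->
  rrsat (t * m ^ 2).+1 (t + 2) <= ((t * m ^ 2).+1 * (t * m)) %/ 2.
Proof.
move=> t0; rewrite -card_vertex.
apply: leq_trans (rrsat_le_nedges _ _ _ (construction_rrsat t0)) _.
rewrite /nedges (card_edges _ _ (t * m)) // => v.
by rewrite deg_rel_graph card_adj.
Qed.

End Construction.

(** * Asymptotic estimates *)

Lemma rrsat_ind (Q : nat -> Prop) n r : Q (n * n) ->
  (forall E : {set 'I_n * 'I_n}, rrsat_graph r E -> Q (nedges E)) ->
  Q (rrsat n r).
Proof.
move=> Qn QE; apply: (big_ind Q) => // [x y|E /asboolP]; last exact: QE.
by rewrite /minn; case: ifP.
Qed.

Local Open Scope ring_scope.

(** A bound at arbitrarily large indices bounds the infimum of every tail. This fits a construction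
    available only for special [n]. *)
Lemma limn_einf_le (R : realType) (u : nat -> \bar R) (x : \bar R) :
  (forall N, exists2 n, (N <= n)%N & (u n <= x)%E) -> (limn_einf u <= x)%E.
Proof.
move=> ux; rewrite limn_einf_lim; apply: lime_le; first exact: is_cvg_einfs.
apply: nearW => N; have [n Nn unx] := ux N.
by apply: le_trans unx; apply: ereal_inf_lbound; exists n.
Qed.

Lemma sqrt_natr_le (R : realType) (n k : nat) : (n <= k ^ 2)%N ->
  Num.sqrt n%:R <= k%:R :> R.
Proof.
by move=> nk; rewrite -[leRHS]ger0_norm // -sqrtr_sqr -natrX ler_wsqrtr ?ler_nat.
Qed.

Lemma le_sqrt_natr (R : realType) (n k : nat) : (k ^ 2 <= n)%N ->
  k%:R <= Num.sqrt n%:R :> R.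
Proof.
by move=> nk; rewrite -[leLHS]ger0_norm // -sqrtr_sqr -natrX ler_wsqrtr ?ler_nat.
Qed.

(** [9 <= n] forces [d >= 1], so [8 (1 + d + d^2)] is at most [24 d^2]. The factor 4 in place of 2
    absorbs the rounding in [nedges]. *)
Lemma nedges_lower_bound n r (E : {set 'I_n * 'I_n}) : (3 <= r)%N -> (9 <= n)%N ->
  rrsat_graph r E -> exists d, (n <= (5 * d) ^ 2)%N /\ (n * d <= 4 * nedges E)%N.
Proof.
move=> r3; case: n E => // n E n9 HE.
have [_ /regularP Ereg _ _] := HE.
pose d := deg E ord0.
have Ed v : deg E v = d by exact: Ereg.
have := rrsat_graph_degree _ _ _ _ r3 (leq_trans _ n9) HE Ed => /(_ isT) nd.
have d0 : (0 < d)%N by case: d {Ed} nd => //; lia.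
exists d; split; first by nia.
by rewrite /nedges (card_edges _ _ _ Ed); nia.
Qed.

Theorem theorem1p4 (R : realType) :
  (* (i) rrsat(n, K_{t+2}) = Omega(n^{3/2}) *)
  (forall t : nat, (1 <= t)%N ->
     exists c : R, 0 < c /\ exists N : nat, forall n : nat, (N <= n)%N ->
       c * (n%:R * Num.sqrt n%:R) <= (rrsat n (t + 2))%:R) /\
  (* (ii) liminf rrsat(n, K_{t+2}) / n^{3/2} <= C_t *)
  (forall t : nat, (1 <= t)%N ->
     exists C : R,
       (limn_einf (fun n : nat =>
          ((rrsat n (t + 2))%:R / (n%:R * Num.sqrt n%:R))%:E) <= C%:E)%E).
Proof.
split=> t t0.
(* The constant is [20 = 5 * 4], from [sqrt n <= 5 d] and [n d <= 4 * nedges E]. *)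
- exists 20%:R^-1; split; first by rewrite invr_gt0.
  exists 9%N => n n9; have n0 : 0 <= n%:R :> R by [].
  apply: (rrsat_ind (fun k => _ <= k%:R)) => [|E HE].
    (* The default value [n * n] of the minimum has to satisfy the bound too. *)
    have sn : Num.sqrt n%:R <= n%:R :> R by apply: sqrt_natr_le; nia.
    by rewrite natrM; have := sqrtr_ge0 (n%:R : R); nra.
  have [|d [nd dE]] := nedges_lower_bound _ _ _ _ n9 HE; first by lia.
  have {}nd : Num.sqrt n%:R <= 5 * d%:R :> R by rewrite -natrM sqrt_natr_le.
  have {}dE : n%:R * d%:R <= 4 * (nedges E)%:R :> R by rewrite -!natrM ler_nat.
  have := ler_wpM2l n0 nd; lra.
(* For [n = 1 + t m^2] the degree [t m] is at most [t * sqrt n]; the factor one half in the edge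
   count is given away. *)
- exists t%:R; apply: limn_einf_le => N.
  exists (t * N.*2.+2 ^ 2).+1; first by nia.
  have := rrsat_construction t N t0.
  set m := N.*2.+2; set n := (t * m ^ 2).+1 => rr.
  have {}rr : (rrsat n (t + 2))%:R <= n%:R * (t%:R * m%:R) :> R.
    by rewrite -!natrM ler_nat (leq_trans rr) // leq_div.
  have mn : m%:R <= Num.sqrt n%:R :> R by apply: le_sqrt_natr; rewrite /n; nia.
  have n0 : 0 < n%:R :> R by rewrite ltr0n.
  rewrite lee_fin ler_pdivrMr ?mulr_gt0 ?sqrtr_gt0 //.
  apply: le_trans rr _; rewrite mulrCA ler_wpM2l // ler_wpM2l //.
Qed.
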